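(* Let $(Y,\mathbf{X})$ and $(Y',\mathbf{X}')$ be random vectors with $Y,Y'$ real-valued and $\mathbf{X},\mathbf{X}'$ taking values in $\mathbb{R}^p$, $\mathbb{R}^{p'}$. Assume that the (measurable) function $g\colon\mathbb{R}^p\to\mathbb{R}$ is sufficient for $Y\mid\mathbf{X}$ and that the (measurable) function $h\colon\mathbb{R}^{p'}\to\mathbb{R}$ is sufficient for $Y'\mid\mathbf{X}'$. Then the following statements hold true: (i) If $(Y,g(\mathbf{X}))\preccurlyeq_{ccx}(Y',h(\mathbf{X}'))$, then $(Y,\mathbf{X})\preccurlyeq_{ccx}(Y',\mathbf{X}')$. (ii) Assume that $\overline{\mathrm{Ran}(F_Y)}=\overline{\mathrm{Ran}(F_{Y'})}$, $Y\uparrow_{st}g(\mathbf{X})$, and $Y'\uparrow_{st}h(\mathbf{X}')$. Then $C_{Y,g(\mathbf{X})}\le_c C_{Y',h(\mathbf{X}')}$ implies $(Y,\mathbf{X})\preccurlyeq_{ccx}(Y',\mathbf{X}')$. (iii) Assume that $\overline{\mathrm{Ran}(F_Y)}=\overline{\mathrm{Ran}(F_{Y'})}$, $Y\downarrow_{st}g(\mathbf{X})$, and $Y'\downarrow_{st}h(\mathbf{X}')$. Then $C_{Y,g(\mathbf{X})}\ge_c C_{Y',h(\mathbf{X}')}$ implies $(Y,\mathbf{X})\preccurlyeq_{ccx}(Y',\mathbf{X}')$.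
   Context: A function $g$ is sufficient for $Y\mid\mathbf{X}$ if the conditional distribution of $Y$ given $\mathbf{X}=\mathbf{x}$ equals the conditional distribution of $Y$ given $g(\mathbf{X})=g(\mathbf{x})$ for $P^{\mathbf{X}}$-almost all $\mathbf{x}$ (equivalently, $Y$ and $\mathbf{X}$ are conditionally independent given $g(\mathbf{X})$). $Y\uparrow_{st}Z$ means $Y$ is stochastically increasing in $Z$: $\mathbb{E}[f(Y)\mid Z=t]$ is increasing in $t$ for all increasing $f$ such that the expectations exist; $Y\downarrow_{st}Z$ means $-Y\uparrow_{st}Z$. $C_{Y,Z}$ denotes a copula of $(Y,Z)$ in the sense of Sklar's theorem, i.e. a bivariate distribution function with uniform marginals on $(0,1)$ satisfying $F_{Y,Z}=C_{Y,Z}\circ(F_Y,F_Z)$; it is uniquely determined on $\mathrm{Ran}(F_Y)\times\mathrm{Ran}(F_Z)$. For copulas, $C\le_c C'$ (concordance order) means $C(u,v)\le C'(u,v)$ for all $(u,v)\in[0,1]^2$; $\ge_c$ is the reverse relation. $F_Y$ is the distribution function of $Y$, $\mathrm{Ran}(F_Y)$ its range, $\overline{\,\cdot\,}$ closure, $q_Y(v)=\inf\{y\mid F_Y(y)\ge v\}$, $v\in(0,1)$. For bounded random variables, $S\le_{cx}T$ means $\mathbb{E}\varphi(S)\le\mathbb{E}\varphi(T)$ for all convex $\varphi\colon\mathbb{R}\to\mathbb{R}$. Conditional convex order: $(Y,\mathbf{X})\preccurlyeq_{ccx}(Y',\mathbf{X}')$ means $P(Y\ge q_Y(v)\mid\mathbf{X})\le_{cx}P(Y'\ge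 q_{Y'}(v)\mid\mathbf{X}')$ for all $v\in(0,1)$.
   Formalization: In (ii) and (iii) the copula of (Y',h(X')) is also required to interpolate linearly across atoms of h(X') (automatic if h(X') has none); for an arbitrary Sklar copula the claim fails, e.g. X=Y uniform, g=id, h constant, Y' uniform independent of X'. *)

(* Defs.v *)
From HB Require Import structures.
From mathcomp Require Import all_boot all_order all_algebra.
From mathcomp Require Import all_classical all_reals all_analysis.

Set Implicit Arguments.
Unset Strict Implicit.
Unset Printing Implicit Defensive.

Import Order.TTheory GRing.Theory Num.Theory.
Import numFieldNormedType.Exports.

Local Open Scope classical_set_scope.
Local Open Scope ring_scope.

Section conditioning.
Context d (T : measurableType d) (R : realType) (P : probability T R).

(* [m] is a version of x |-> E[xi | X = x]; equivalently m(X) is a version of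
   E[xi | X]. *)
Definition cond_expectation dS (S : measurableType dS) (xi : T -> R)
    (X : {RV P >-> S}) (m : S -> R) : Prop :=
  [/\ measurable_fun setT m,
      P.-integrable setT (fun w => (m (X w))%:E) &
      forall B : set S, measurable B ->
        (\int[P]_(w in X @^-1` B) (m (X w))%:E =
         \int[P]_(w in X @^-1` B) (xi w)%:E)%E].

(* [m] is a version of x |-> P(A | X = x). *)
Definition cond_probability dS (S : measurableType dS) (A : set T)
    (X : {RV P >-> S}) (m : S -> R) : Prop :=
  cond_expectation (\1_A : T -> R) X m.

(* [k] is a regular conditional distribution of Y given X. *)
Definition cond_distribution dS (S : measurableType dS) (Y : {RV P >-> R})
    (X : {RV P >-> S}) (k : R.-pker S ~> R) : Prop :=
  forall (A : set S) (B : set R), measurable A -> measurable B ->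
    P (X @^-1` A `&` Y @^-1` B) = (\int[distribution P X]_(x in A) k x B)%E.

(* Regular conditional distributions of a real random variable exist and are
   almost surely unique, so nothing depends on the choice of k and l. *)
Definition sufficient dS (S : measurableType dS) (g : {mfun S >-> R})
    (Y : {RV P >-> R}) (X : {RV P >-> S}) : Prop :=
  exists (k : R.-pker S ~> R) (l : R.-pker R ~> R),
    [/\ cond_distribution Y X k,
        cond_distribution Y (g \o X : {RV P >-> R}) l &
        {ae distribution P X, forall x,
           forall B : set R, measurable B -> k x B = l (g x) B}].

(* t |-> E[f(Y) | Z = t] is only defined up to P^Z-null sets, hence the set A.
   (A version that is finite and monotone on all of R need not exist: take
   Z uniform on (0,1) and E[f(Y) | Z = t] unbounded near t = 1.) *)
Definition stoch_increasing (Y : T -> R) (Z : {RV P >-> R}) : Prop :=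
  forall f : R -> R, {homo f : x y / x <= y} ->
    P.-integrable setT (fun w => (f (Y w))%:E) ->
    exists m : R -> R, cond_expectation (fun w => f (Y w)) Z m /\
      exists A : set R, [/\ measurable A, distribution P Z A = 1%E &
        {in A &, {homo m : s t / s <= t}}].

Definition stoch_decreasing (Y : T -> R) (Z : {RV P >-> R}) : Prop :=
  stoch_increasing (fun w => - Y w) Z.

Definition df (Y : {RV P >-> R}) (y : R) : R := fine (cdf Y y).

Definition quantile (Y : {RV P >-> R}) (v : R) : R :=
  inf [set y | v <= df Y y].

End conditioning.

Section orders.
Context d (T : measurableType d) (R : realType) (P : probability T R).
Context d' (T' : measurableType d') (P' : probability T' R).

(* Used for (almost surely) bounded S and U only, so that both expectations
   exist. *)
Definition convex_order (S : T -> R) (U : T' -> R) : Prop :=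
  forall phi : R -> R, convex_function (setT : set R^o) phi ->
    ('E_P[fun w => phi (S w)] <= 'E_P'[fun w => phi (U w)])%E.

Definition ccx_order dS (S : measurableType dS) dS' (S' : measurableType dS')
    (Y : {RV P >-> R}) (X : {RV P >-> S})
    (Y' : {RV P' >-> R}) (X' : {RV P' >-> S'}) : Prop :=
  forall v : R, 0 < v < 1 ->
  forall (m : S -> R) (m' : S' -> R),
    cond_probability [set w | quantile Y v <= Y w] X m ->
    cond_probability [set w | quantile Y' v <= Y' w] X' m' ->
    convex_order (fun w => m (X w)) (fun w => m' (X' w)).

End orders.

Section copulas.
Context (R : realType).

Definition is_copula (C : R -> R -> R) : Prop :=
  exists mu : probability (R * R)%type R,
    [/\ forall A : set R, measurable A ->
          mu (fst @^-1` A) = uniform_prob (@ltr01 R) A,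
        forall A : set R, measurable A ->
          mu (snd @^-1` A) = uniform_prob (@ltr01 R) A &
        forall u v : R, C u v = fine (mu (`]-oo, u] `*` `]-oo, v]))].

Definition concordance_le (C C' : R -> R -> R) : Prop :=
  forall u v : R, 0 <= u <= 1 -> 0 <= v <= 1 -> C u v <= C' u v.

Context d (T : measurableType d) (P : probability T R).

Definition copula_of (C : R -> R -> R) (Y Z : {RV P >-> R}) : Prop :=
  is_copula C /\
  forall y z : R,
    fine (P [set w | Y w <= y /\ Z w <= z]) = C (df Y y) (df Z z).

(* Sklar's identity says nothing about C on the gaps of Ran(F_Z), that is on
   the intervals (P(Z < z), P(Z <= z)) attached to the atoms z of Z.  The
   following fixes the version of C there: it is the one obtained from the
   distributional transform P(Z < z) + l P(Z = z) of Z, with l uniform and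
   independent of (Y, Z), i.e. the linear interpolation of C(F_Y(y), .).
   For l = 1 it is Sklar's identity, and it is automatic if Z has no atoms
   (copula_of_atomless below).  A version has to be fixed to make comparisons
   of copulas meaningful: if Z is constant, then every copula, including the
   upper Frechet bound, is a copula of (Y, Z). *)
Definition atoms_interpolated (C : R -> R -> R) (Y Z : {RV P >-> R}) : Prop :=
  forall y z l : R, 0 <= l <= 1 ->
    C (df Y y) (fine (P [set w | Z w < z]) + l * fine (P [set w | Z w = z])) =
    fine (P [set w | Y w <= y /\ Z w < z])
      + l * fine (P [set w | Y w <= y /\ Z w = z]).

Lemma copula_of_atomless (C : R -> R -> R) (Y Z : {RV P >-> R}) :
  (forall z, P [set w | Z w = z] = 0%E) ->
  copula_of C Y Z -> atoms_interpolated C Y Z.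
Proof.
move=> Z0 [_ CE] y z l _.
have mY : measurable [set w | Y w <= y].
  have -> : [set w | Y w <= y] = Y @^-1` `]-oo, y].
    by apply/seteqP; split=> w /=; rewrite in_itv.
  by rewrite -[_ @^-1` _]setTI; exact: measurable_funP.
have mZlt : measurable [set w | Z w < z].
  have -> : [set w | Z w < z] = Z @^-1` `]-oo, z[.
    by apply/seteqP; split=> w /=; rewrite in_itv.
  by rewrite -[_ @^-1` _]setTI; exact: measurable_funP.
have mZ : measurable [set w | Z w = z].
  rewrite -[[set w | _]]/(Z @^-1` [set z]) -[_ @^-1` _]setTI.
  exact: measurable_funP.
have leZ : [set w | Z w <= z] = [set w | Z w < z] `|` [set w | Z w = z].
  apply/seteqP; split=> w /=.
    by rewrite le_eqVlt => /orP[/eqP|]; [right|left].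
  by case=> [/ltW|->].
have YZ0 : P [set w | Y w <= y /\ Z w = z] = 0%E.
  have sub : [set w | Y w <= y /\ Z w = z] `<=` [set w | Z w = z] by move=> w [].
  exact: (subset_measure0 (measurableI _ _ mY mZ) mZ sub (Z0 z)).
have Plt : P [set w | Z w < z] = P [set w | Z w <= z].
  by rewrite leZ (measureU0 mZlt mZ (Z0 z)).
have PYlt : P [set w | Y w <= y /\ Z w < z] = P [set w | Y w <= y /\ Z w <= z].
  have -> : [set w | Y w <= y /\ Z w <= z] =
      ([set w | Y w <= y /\ Z w < z] `|` [set w | Y w <= y /\ Z w = z]).
    by rewrite -[LHS]/([set w | Y w <= y] `&` [set w | Z w <= z]) leZ setIUr.
  by rewrite (measureU0 (measurableI _ _ mY mZlt) (measurableI _ _ mY mZ) YZ0).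
rewrite Z0 YZ0 /= !mulr0 !addr0 PYlt CE /df Plt; congr (C _ (fine (P _))).
Qed.

End copulas.

(* Main.v *)
(** By sufficiency every version of [P(Y >= q | X)] is almost surely a function
    [n] of [g(X)], so that (i) is a transfer of versions and (ii), (iii) are
    statements about [Z = g(X)] and [Z' = h(X')].

    Convex order between [0, 1]-valued variables with equal means follows from
    the comparison of the excesses [E (S - c)^+]: interpolate the convex
    function on a grid.  The means agree because [P(Y < q_Y(v))] is the supremum
    of [Ran(F_Y)] below [v], hence depends on the closure of the range only.

    Let [A] be [Y < q] in case (ii) and [Y >= q] in case (iii), so that
    [m(Z) = P(A | Z)] is decreasing in [Z].  Then [m(Z) > c] is, up to a null
    set, an event [Z < z] or [Z <= z], of probability [s], say, and
    [E (m(Z) - c)^+ = P(A, m(Z) > c) - c s] is read off [C(P(Y < q), s)].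
    Splitting the atom of [Z'] at its [s]-quantile by a weight [l] gives a
    function [xi] of [Z'] with values in [0, 1] and mean [s], and
    [E (m'(Z') - c)^+ >= E (m'(Z') - c) xi] is read off [C'(P(Y' < q'), s)] by
    the interpolation condition. *)

Require Import Defs.
From mathcomp Require Import all_boot all_order all_algebra.
From mathcomp Require Import all_classical all_reals all_analysis.
From mathcomp Require Import measurable_realfun ring lra.

Set Implicit Arguments.
Unset Strict Implicit.
Unset Printing Implicit Defensive.

Import Order.TTheory GRing.Theory Num.Theory.
Import numFieldNormedType.Exports.

Local Open Scope classical_set_scope.
Local Open Scope ring_scope.

(** * Convex functions and convex order *)

Section convex_functions.
Context (R : realType) (phi : R -> R).
Hypothesis phi_convex : convex_function (setT : set R^o) phi.

(** [b] is the mixture of [a] and [c] with weight [(c - b) / (c - a)] on [a]. Clearing the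
    denominator covers the degenerate case [a = c] and leaves a polynomial inequality for later
    arithmetic. *)
Lemma convex_three_points (a b c : R) : a <= b -> b <= c ->
  (c - a) * phi b <= (c - b) * phi a + (b - a) * phi c.
Proof.
move=> ab bc; have [ac|ac] := eqVneq a c.
  have ba : b = a by apply/le_anti; rewrite ab {1}ac bc.
  by rewrite ba -ac !subrr !mul0r addr0.
have ca0 : 0 < c - a by rewrite subr_gt0 lt_neqAle ac (le_trans ab bc).
have t0 : 0 <= (c - b) / (c - a) by apply: divr_ge0; lra.
have t1 : (c - b) / (c - a) <= 1 by rewrite ler_pdivrMr// mul1r; lra.
have := @phi_convex (Itv01 t0 t1) a c (in_setT _) (in_setT _).
rewrite !convRE /= /unstable.onem.
rewrite (_ : phi _ = phi b); last first.
  congr phi; transitivity ((c - b) / (c - a) * a + (1 - (c - b) / (c - a)) * c).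
    by [].
  by field; rewrite gt_eqF.
rewrite -(ler_pM2l ca0) => /le_trans; apply.
rewrite le_eqVlt; apply/orP; left; apply/eqP.
by field; rewrite gt_eqF.
Qed.

(** Chord slopes of a convex function increase, so the slope over [[x, y]] lies between those over
    [[-1, 0]] and [[1, 2]]. Convexity beyond the unit interval is what bounds the slope up to 0 and
    1. *)
Lemma convex_lipschitz01 (x y : R) : 0 <= x -> x <= y -> y <= 1 ->
  `|phi y - phi x| <=
  (`|phi 0 - phi (-1)| + `|phi 2 - phi 1|) * (y - x).
Proof.
move=> x0 xy y1.
have up : phi y - phi x <= (phi 2 - phi 1) * (y - x).
  (* The slope over [[x, y]] is at most that over [[x, 2]] ([h2]), which is at most that over
     [[1, 2]] ([h1]). *)
  have h1 := @convex_three_points x 1 2 ltac:(lra) ltac:(lra).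
  have h2 := @convex_three_points x y 2 ltac:(lra) ltac:(lra).
  rewrite -(@ler_pM2l _ (2 - x)); last lra.
  have := ler_wpM2l (_ : 0 <= y - x) h1; rewrite subr_ge0 => /(_ xy).
  by nra.
have lo : (phi 0 - phi (-1)) * (y - x) <= phi y - phi x.
  have h1 := @convex_three_points (-1) 0 y ltac:(lra) ltac:(lra).
  have h2 := @convex_three_points (-1) x y ltac:(lra) ltac:(lra).
  rewrite -(@ler_pM2l _ (1 + y)); last lra.
  have := ler_wpM2l (_ : 0 <= y - x) h1; rewrite subr_ge0 => /(_ xy).
  by nra.
have d0 : 0 <= y - x by lra.
have n1 : (phi 2 - phi 1) * (y - x) <= `|phi 2 - phi 1| * (y - x).
  by rewrite ler_wpM2r// ler_norm.
have n2 : - (phi 0 - phi (-1)) * (y - x) <= `|phi 0 - phi (-1)| * (y - x).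
  by rewrite ler_wpM2r// -normrN ler_norm.
have n3 : 0 <= `|phi 2 - phi 1| * (y - x) by rewrite mulr_ge0.
have n4 : 0 <= `|phi 0 - phi (-1)| * (y - x) by rewrite mulr_ge0.
by rewrite ler_norml mulrDl; apply/andP; split; lra.
Qed.

(** Strict sublevel sets of a convex function are intervals, hence Borel, and the rays []-oo, r[]
    generate the Borel sets. *)
Lemma convex_measurable : measurable_fun setT phi.
Proof.
apply: (measurability (@RGenInftyO.G R)) => [|/= _ [_] [r] -> <-].
  exact: RGenInftyO.measurableE.
apply: measurableI => //; apply: is_interval_measurable => s t/=.
rewrite !in_itv/= => fs ft u /andP[su ut]; rewrite in_itv/=.
have [tu|ut'] := leP t u.
  by have -> : u = t by apply/le_anti; rewrite ut tu.
have := convex_three_points su ut.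
have : (t - u) * phi s <= (t - u) * r by rewrite ler_pM2l ?subr_gt0// ltW.
have : (u - s) * phi t <= (u - s) * r by rewrite ler_wpM2l ?subr_ge0// ltW.
have [us|] := eqVneq s u; first by rewrite -us.
move=> nsu h1 h2 h3.
have su' : s < u by rewrite lt_neqAle nsu.
have h4 : (t - u) * phi s < (t - u) * r by rewrite ltr_pM2l ?subr_gt0.
rewrite -(@ltr_pM2l _ (t - s)) ?subr_gt0//; last exact: lt_trans ut'.
by nra.
Qed.

(** Serves to pass from a convex order between [1 - S] and [1 - U] to one between [S] and [U]. *)
Lemma convex_reflect : convex_function (setT : set R^o) (fun x => phi (1 - x)).
Proof.
move=> t x y _ _; have := @phi_convex t (1 - x) (1 - y) (in_setT _) (in_setT _).
suff -> : conv t (1 - x : convex_lmodType R^o) (1 - y) =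
    1 - conv t (x : convex_lmodType R^o) y by [].
transitivity (t%:num * (1 - x) + (1 - t%:num) * (1 - y)); first by [].
transitivity (1 - (t%:num * x + (1 - t%:num) * y)); last by [].
by ring.
Qed.

End convex_functions.

(** * Piecewise linear interpolation of a convex function *)

Section piecewise_linear.
Context (R : realType) (phi : R -> R) (n : nat).
Definition grid_point (k : nat) : R := k%:R / n.+1%:R.
Definition chord_slope (k : nat) : R :=
  n.+1%:R * (phi (grid_point k.+1) - phi (grid_point k)).

(* On [0, grid_point k.+1] this is the piecewise linear interpolation of [phi]
   at the grid points; beyond, the last chord is continued. *)
Fixpoint interpolation (k : nat) (x : R) : R :=
  if k is j.+1
  then interpolation j x +
    (chord_slope j.+1 - chord_slope j) * Num.max (x - grid_point j.+1) 0
  else phi 0 + chord_slope 0 * x.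

Hypothesis phi_convex : convex_function (setT : set R^o) phi.

Let grid_pointS k : grid_point k.+1 = grid_point k + n.+1%:R^-1.
Proof. by rewrite /grid_point -addn1 natrD mulrDl mul1r. Qed.

Let n0 : 0 < n.+1%:R :> R. Proof. by rewrite ltr0n. Qed.

(** These differences are the coefficients of the hinges [Num.max (x - c) 0] in [interpolation];
    their sign lets inequalities between excesses be added up. *)
Lemma chord_slope_incr k : 0 <= chord_slope k.+1 - chord_slope k.
Proof.
rewrite /chord_slope -mulrBr; apply: mulr_ge0; first exact: ltW.
have in0 : 0 < n.+1%:R^-1 :> R by rewrite invr_gt0.
have h1 : grid_point k <= grid_point k.+1 by rewrite grid_pointS lerDl ltW.
have h2 : grid_point k.+1 <= grid_point k.+2.
  by rewrite (grid_pointS k.+1) lerDl ltW.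
have := convex_three_points phi_convex h1 h2.
have -> : grid_point k.+2 - grid_point k = 2 * n.+1%:R^-1.
  by rewrite !grid_pointS; ring.
have -> : grid_point k.+2 - grid_point k.+1 = n.+1%:R^-1.
  by rewrite !grid_pointS; ring.
have -> : grid_point k.+1 - grid_point k = n.+1%:R^-1.
  by rewrite grid_pointS; ring.
move=> h; suff : n.+1%:R^-1 * (2 * phi (grid_point k.+1)) <=
    n.+1%:R^-1 * (phi (grid_point k) + phi (grid_point k.+2)).
  by rewrite ler_pM2l//; lra.
by rewrite mulrDr mulrA (mulrC _ 2).
Qed.

(** To the right of the last grid point used all hinges are active, and the sum telescopes to the
    last chord. *)
Lemma interpolation_last k x : grid_point k <= x ->
  interpolation k x = phi (grid_point k) + chord_slope k * (x - grid_point k).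
Proof.
elim: k => [|k IH] xk /=.
  by rewrite /grid_point mul0r subr0.
have xk' : grid_point k <= x.
  by apply: le_trans xk; rewrite grid_pointS lerDl invr_ge0 ltW.
rewrite IH// max_l ?subr_ge0// /chord_slope (grid_pointS k).
by field; rewrite gt_eqF.
Qed.

(** The chord lies above [phi] by convexity. The error is at most twice the Lipschitz constant times
    the mesh: once for the rise of the chord from the left grid point, once for the variation of
    [phi] from there to [x]. *)
Lemma interpolation_chord k x : grid_point k <= x -> x <= grid_point k.+1 ->
    grid_point k.+1 <= 1 ->
  phi x <= interpolation k x <=
  phi x + 2 * (`|phi 0 - phi (-1)| + `|phi 2 - phi 1|) / n.+1%:R.
Proof.
move=> kx xk k1; rewrite interpolation_last//.
have k0 : 0 <= grid_point k by rewrite divr_ge0.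
have l1 := convex_lipschitz01 phi_convex k0 kx (le_trans xk k1).
have l2 := convex_lipschitz01 phi_convex k0 (le_trans kx xk) k1.
have h := convex_three_points phi_convex kx xk.
move: l1 l2 h; rewrite /chord_slope; set M := _ + `|_ - phi 1|.
have M0 : 0 <= M by rewrite addr_ge0.
have -> : grid_point k.+1 - grid_point k = n.+1%:R^-1.
  by rewrite grid_pointS; ring.
move: xk; rewrite grid_pointS; set a := grid_point k; set b := phi (a + _).
move=> xk l1 l2 h.
have e1 : n.+1%:R * n.+1%:R^-1 = 1 :> R by rewrite divff ?gt_eqF.
move: h l1 l2 xk e1 n0; set N := n.+1%:R; set i := N^-1.
move=> h l1 l2 xk e1 N0.
have h' := ler_wpM2l (ltW N0) h.
(* The Lipschitz bound over the full cell bounds the slope of its chord. *)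
have l2' : N * (b - phi a) <= M.
  by rewrite -(mulr1 M) -e1 mulrCA ler_pM2l// (le_trans _ l2)// ler_norm.
have l2'' : N * (b - phi a) * (x - a) <= M * i.
  apply: (@le_trans _ _ (M * (x - a))); first by rewrite ler_wpM2r// subr_ge0.
  by rewrite ler_wpM2l//; lra.
have l1' : phi a - phi x <= M * i.
  apply: (@le_trans _ _ (M * (x - a))); last by rewrite ler_wpM2l//; lra.
  by apply: le_trans l1; rewrite -normrN opprB ler_norm.
apply/andP; split; last by lra.
have -> : phi x = N * (i * phi x) by rewrite mulrA e1 mul1r.
apply: (le_trans h').
rewrite le_eqVlt; apply/orP; left; apply/eqP.
have -> : N * ((a + i - x) * phi a + (x - a) * b) =
  N * i * phi a + N * (b - phi a) * (x - a) by ring.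
by rewrite e1 mul1r.
Qed.

(** Hinges placed to the right of [x] vanish at [x], so the induction descends to the cell that
    contains [x]. *)
Lemma interpolation_approx k x : 0 <= x -> x <= grid_point k.+1 ->
    grid_point k.+1 <= 1 ->
  phi x <= interpolation k x <=
  phi x + 2 * (`|phi 0 - phi (-1)| + `|phi 2 - phi 1|) / n.+1%:R.
Proof.
move=> x0; elim: k => [|k IH] xk k1.
- apply: interpolation_chord => //.
  by rewrite /grid_point mul0r.
- have [kx|/ltW xk'] := leP (grid_point k.+1) x.
    exact: interpolation_chord.
  rewrite /= max_r ?subr_le0// mulr0 addr0; apply: IH => //.
  by apply: le_trans k1; rewrite (grid_pointS k.+1) lerDl invr_ge0 ltW.
Qed.

End piecewise_linear.

(** * Integrability of bounded functions *)

Section bounded_functions.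
Context d (T : measurableType d) (R : realType) (P : probability T R).

Lemma bounded_integrable (f : T -> R) (M : R) : measurable_fun setT f ->
  (forall w, `|f w| <= M) -> P.-integrable setT (EFin \o f).
Proof.
move=> mf fM; apply: measurable_bounded_integrable => //.
  by rewrite ltey_eq fin_num_measure.
exists M; split; first exact: num_real.
by move=> x Mx w _; apply: le_trans (fM w) (ltW Mx).
Qed.

Lemma expectation_Rintegral (f : T -> R) : P.-integrable setT (EFin \o f) ->
  'E_P[f]%E = (\int[P]_w f w)%:E.
Proof.
by move=> fi; rewrite unlock /Rintegral fineK//; exact: integrable_fin_num.
Qed.

Lemma integrableD_fun (f g : T -> R) : P.-integrable setT (EFin \o f) ->
  P.-integrable setT (EFin \o g) ->
  P.-integrable setT (EFin \o (fun w => f w + g w)).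
Proof. by move=> fi gi; exact: (integrableD measurableT fi gi). Qed.

Lemma integrableZl_fun (f : T -> R) (c : R) : P.-integrable setT (EFin \o f) ->
  P.-integrable setT (EFin \o (fun w => c * f w)).
Proof. by move=> fi; exact: (integrableZl measurableT c fi). Qed.

Lemma integrable_cst_fun (c : R) : P.-integrable setT (EFin \o (fun=> c)).
Proof. by apply: (@bounded_integrable _ `|c|). Qed.

Lemma Rintegral_cstT (c : R) : \int[P]_w (c : R) = c.
Proof. by rewrite Rintegral_cst//= probability_setT mulr1. Qed.

Section unit_valued.
Context (S : T -> R).
Hypotheses (mS : measurable_fun setT S) (S01 : forall w, 0 <= S w <= 1).

Lemma unit_integrable : P.-integrable setT (EFin \o S).
Proof.
apply: (@bounded_integrable _ 1) => // w.
by have /andP[s0 s1] := S01 w; rewrite ger0_norm.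
Qed.

Lemma excess_measurable (c : R) :
  measurable_fun setT (fun w => Num.max (S w - c) 0).
Proof. by apply: measurable_maxr => //; exact: measurable_funB. Qed.

Lemma excess_integrable (c : R) :
  P.-integrable setT (EFin \o (fun w => Num.max (S w - c) 0)).
Proof.
apply: (@bounded_integrable _ (1 + `|c|)); first exact: excess_measurable.
move=> w; have /andP[s0 s1] := S01 w; have := ler_norm (- c); rewrite normrN.
have := normr_ge0 c; have [h|h] := leP (S w - c) 0 => ? ?.
  by rewrite normr0; lra.
by rewrite gtr0_norm//; lra.
Qed.

Lemma interpolation_integrable (phi : R -> R) n k :
  P.-integrable setT (EFin \o (fun w => interpolation phi n k (S w))).
Proof.
elim: k => [|k IH] /=; apply: integrableD_fun => //.
- exact: integrable_cst_fun.
- exact: integrableZl_fun unit_integrable.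
- exact: integrableZl_fun (excess_integrable _).
Qed.

End unit_valued.

End bounded_functions.

(** * Convex order from means and excesses *)

Section convex_order_criterion.
Context d (T : measurableType d) (R : realType) (P : probability T R).
Context d' (T' : measurableType d') (P' : probability T' R).
Context (S : T -> R) (U : T' -> R).
Hypotheses (mS : measurable_fun setT S) (S01 : forall w, 0 <= S w <= 1).
Hypotheses (mU : measurable_fun setT U) (U01 : forall w, 0 <= U w <= 1).

(** For the interpolation of [phi], equal means settle the affine part and the excess inequalities
    settle the hinges. The interpolation error vanishes as the grid is refined. *)
Lemma convex_order_of_excess :
  \int[P]_w S w = \int[P']_w U w ->
  (forall c, \int[P]_w Num.max (S w - c) 0 <= \int[P']_w Num.max (U w - c) 0) ->
  convex_order P P' S U.
Proof.
move=> SU exSU phi cphi.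
pose M := `|phi 0 - phi (-1)| + `|phi 2 - phi 1|.
have M0 : 0 <= M by rewrite addr_ge0.
have bound x : 0 <= x <= 1 -> `|phi x| <= `|phi 0| + M.
  move=> /andP[x0 x1].
  have := convex_lipschitz01 cphi (lexx 0) x0 x1; rewrite -/M subr0 => h.
  rewrite -(subrK (phi 0) (phi x)) (le_trans (ler_normD _ _))// addrC lerD2l.
  by apply: (le_trans h); rewrite ler_piMr.
have mphi := convex_measurable cphi.
have iS : P.-integrable setT (EFin \o (fun w => phi (S w))).
  apply: bounded_integrable (fun w => bound _ (S01 w)).
  exact: measurableT_comp mphi mS.
have iU : P'.-integrable setT (EFin \o (fun w => phi (U w))).
  apply: bounded_integrable (fun w => bound _ (U01 w)).
  exact: measurableT_comp mphi mU.
rewrite !expectation_Rintegral// lee_fin.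
have approx n : \int[P]_w phi (S w) <= \int[P']_w phi (U w) + 2 * M / n.+1%:R.
  (* The grid point of index [n.+1] is 1, so [interpolation phi n n] is accurate on the whole unit
     interval. *)
  have last01 : n.+1%:R / n.+1%:R = 1 :> R by rewrite divff.
  have inter x : 0 <= x <= 1 ->
      phi x <= interpolation phi n n x <= phi x + 2 * M / n.+1%:R.
    move=> /andP[x0 x1]; apply: interpolation_approx => //;
      by rewrite /grid_point last01.
  apply: (@le_trans _ _ (\int[P]_w interpolation phi n n (S w))).
    apply: le_Rintegral => //; first exact: interpolation_integrable.
    by move=> w _; have /andP[] := inter _ (S01 w).
  apply: (@le_trans _ _ (\int[P']_w interpolation phi n n (U w))); last first.
    rewrite -[X in _ + X](Rintegral_cstT P') -RintegralD//; last first.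
      exact: integrable_cst_fun.
    apply: le_Rintegral => //; first exact: interpolation_integrable.
      by apply: integrableD_fun => //; exact: integrable_cst_fun.
    by move=> w _; have /andP[] := inter _ (U01 w).
  have excess_fin k := chord_slope_incr n cphi k.
  (* The induction is on the number of hinges alone; the mesh stays fixed. *)
  elim: {2 4}n => [|k IH] /=.
    rewrite !RintegralD ?Rintegral_cstT ?RintegralZl ?SU//;
      by [exact: integrable_cst_fun | exact/integrableZl_fun/unit_integrable
         | exact: unit_integrable].
  rewrite !RintegralD//; try exact: interpolation_integrable;
    try by apply: integrableZl_fun; exact: excess_integrable.
  rewrite !RintegralZl//; try exact: excess_integrable.
  by rewrite lerD// ler_wpM2l.
(* This [n] makes the error [2 * M / n.+1%:R] at most [e]. *)
apply/ler_addgt0Pr => e e0; pose n := Num.truncn (e^-1 * (2 * M)).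
apply: le_trans (approx n) _; rewrite lerD2l ler_pdivrMr ?ltr0n//.
by rewrite -ler_pdivrMl// ltW// truncnS_gt.
Qed.

End convex_order_criterion.

(** * Conditional expectations *)

Section conditional_expectation.
Context d (T : measurableType d) (R : realType) (P : probability T R).

Lemma ae_distribution dS (S : measurableType dS) (X : {RV P >-> S})
    (Q : S -> Prop) :
  {ae distribution P X, forall x, Q x} -> {ae P, forall w, Q (X w)}.
Proof.
move=> [N [mN N0 QN]]; exists (X @^-1` N); split => //.
  exact: measurable_funPTI.
by move=> w /= nQ; exact: QN.
Qed.

(** After a change of variables, both versions have the same integral over every measurable set
    under the law of [X]. *)
Lemma cond_expectation_unique dS (S : measurableType dS) (xi : T -> R)
    (X : {RV P >-> S}) (m1 m2 : S -> R) :
  cond_expectation xi X m1 -> cond_expectation xi X m2 ->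
  {ae distribution P X, forall x, m1 x = m2 x}.
Proof.
move=> [mm1 i1 e1] [mm2 i2 e2].
have mX : measurable_fun setT X by [].
have mE1 : measurable_fun setT (EFin \o m1) by exact/measurable_EFinP.
have mE2 : measurable_fun setT (EFin \o m2) by exact/measurable_EFinP.
have : ae_eq (distribution P X) setT (EFin \o m1) (EFin \o m2).
  apply: integral_ae_eq => //.
    exact: (integrable_pushforward mX).
  move=> E _ mE.
  have mXE : measurable (X @^-1` E) by exact: measurable_funPTI.
  rewrite !(integral_pushforward mX)//.
  - by rewrite e1// e2.
  - by apply: integrableS i2.
  - by apply: integrableS i1.
by apply: filterS => x /(_ I) [].
Qed.

(** For fixed [B], the disintegration identity carried from the law of [X] back to [P] is the
    defining identity of a conditional probability. Kernel values are at most 1, so [fine] loses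
    nothing. *)
Lemma cond_distribution_probability dS (S : measurableType dS)
    (Y : {RV P >-> R}) (X : {RV P >-> S}) (k : R.-pker S ~> R) (B : set R) :
  measurable B -> cond_distribution Y X k ->
  cond_probability (Y @^-1` B) X (fun x => fine (k x B)).
Proof.
move=> mB Yk.
have mX : measurable_fun setT X by [].
have mk : measurable_fun setT (k ^~ B) by exact: measurable_kernel.
have mfk : measurable_fun setT (fun x => fine (k x B)).
  exact: measurableT_comp mk.
have k1 x : (k x B <= 1)%E.
  by rewrite -(@prob_kernel _ _ _ _ _ k x) le_measure ?inE.
have fk x : k x B \is a fin_num.
  by rewrite ge0_fin_numE// (le_lt_trans (k1 x))// ltry.
have ik : P.-integrable setT (fun w => (fine (k (X w) B))%:E).
  apply: (@bounded_integrable _ _ _ _ _ 1).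
    exact: (measurableT_comp mfk mX).
  move=> w; rewrite ger0_norm ?fine_ge0// -lee_fin fineK//; exact: k1.
split => // A mA.
have mXA : measurable (X @^-1` A) by exact: measurable_funPTI.
have mYB : measurable (Y @^-1` B).
  exact: measurable_funPTI.
rewrite integral_indic// setIC.
apply: etrans (esym (Yk A B mA mB)).
under [RHS]eq_integral do rewrite -(fineK (fk _)).
rewrite (@integral_pushforward _ _ _ _ _ _ mX P A
  (fun x => (fine (k x B))%:E))//.
  exact/measurable_EFinP.
by apply: integrableS ik.
Qed.

(** [n] is read off the kernel [l] of [Y] given [g(X)], which keeps it in [[0, 1]] at every point.
    Any [m] agrees almost surely with the kernel [k], and sufficiency identifies [k x] with
    [l (g x)]. *)
Lemma sufficient_cond_probability dS (S : measurableType dS)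
    (g : {mfun S >-> R}) (Y : {RV P >-> R}) (X : {RV P >-> S}) (B : set R) :
  sufficient g Y X -> measurable B ->
  exists n : R -> R, [/\ measurable_fun setT n, forall t, 0 <= n t <= 1,
    cond_probability (Y @^-1` B) (g \o X : {RV P >-> R}) n &
    forall m, cond_probability (Y @^-1` B) X m ->
      {ae P, forall w, m (X w) = n (g (X w))}].
Proof.
move=> [k [l [Yk Yl kl]]] mB.
have cl := cond_distribution_probability mB Yl.
have ck := cond_distribution_probability mB Yk.
exists (fun t => fine (l t B)); split => //.
- by case: cl.
- move=> t; have l1 : (l t B <= 1)%E.
    by rewrite -(@prob_kernel _ _ _ _ _ l t) le_measure ?inE.
  rewrite fine_ge0//= -lee_fin fineK//.
  by rewrite ge0_fin_numE// (le_lt_trans l1)// ltry.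
- move=> m cm.
  have /ae_distribution := cond_expectation_unique cm ck.
  have /ae_distribution := kl.
  by apply: filterS2 => w /= h ->; rewrite h.
Qed.

End conditional_expectation.

(** Allows versions to be exchanged: the expectations ignore null sets once [phi] is known to be
    measurable. *)
Lemma convex_order_ae d (T : measurableType d) (R : realType)
    (P : probability T R) d' (T' : measurableType d') (P' : probability T' R)
    (S S1 : T -> R) (U U1 : T' -> R) :
  measurable_fun setT S -> measurable_fun setT S1 ->
  measurable_fun setT U -> measurable_fun setT U1 ->
  {ae P, forall w, S w = S1 w} -> {ae P', forall w, U w = U1 w} ->
  convex_order P P' S1 U1 -> convex_order P P' S U.
Proof.
move=> mS mS1 mU mU1 SS1 UU1 + phi cphi => /(_ phi cphi).
have mphi := convex_measurable cphi.
rewrite unlock (@ae_eq_integral _ _ _ P setT (fun w => (phi (S1 w))%:E)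
  (fun w => (phi (S w))%:E))//; last 3 first.
- by apply/measurable_EFinP; exact: measurableT_comp mphi mS.
- by apply/measurable_EFinP; exact: measurableT_comp mphi mS1.
- by apply: filterS SS1 => w ->.
rewrite (@ae_eq_integral _ _ _ P' setT (fun w => (phi (U1 w))%:E)
  (fun w => (phi (U w))%:E))//.
- by apply/measurable_EFinP; exact: measurableT_comp mphi mU.
- by apply/measurable_EFinP; exact: measurableT_comp mphi mU1.
- by apply: filterS UU1 => w ->.
Qed.

Lemma set_ge_preimage (R : realType) T (W : T -> R) (q : R) :
  [set w | q <= W w] = W @^-1` `[q, +oo[.
Proof. by apply/seteqP; split => w /=; rewrite in_itv/= andbT. Qed.

Lemma set_lt_preimage (R : realType) T (W : T -> R) (q : R) :
  [set w | W w < q] = W @^-1` `]-oo, q[.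
Proof. by apply/seteqP; split => w /=; rewrite in_itv. Qed.

(** * Excesses of a conditional probability *)

Section excess.
Context d (T : measurableType d) (R : realType) (P : probability T R).
Context (Z : {RV P >-> R}) (A : set T) (m : R -> R).
Hypotheses (mA : measurable A) (m01 : forall t, 0 <= m t <= 1).
Hypothesis Am : cond_probability A Z m.

Let mm : measurable_fun setT m. Proof. by case: Am. Qed.

Let mmZ : measurable_fun setT (fun w => m (Z w)).
Proof. exact: measurableT_comp. Qed.

Let imZ : P.-integrable setT (EFin \o (fun w => m (Z w))).
Proof. by case: Am. Qed.

Let ex c w := Num.max (m (Z w) - c) 0.

Let iex c : P.-integrable setT (EFin \o ex c).
Proof. by apply: (@excess_integrable _ _ _ P (fun w => m (Z w))). Qed.

Let imZc c : P.-integrable setT (EFin \o (fun w => m (Z w) - c)).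
Proof. by apply: integrableD_fun => //; exact: integrable_cst_fun. Qed.

Let iimZc c (D : set T) : measurable D ->
  P.-integrable setT (EFin \o (fun w => (m (Z w) - c) * \1_D w)).
Proof.
move=> mD; apply: (@bounded_integrable _ _ _ _ _ (1 + `|c|)).
  by apply: measurable_funM => //; exact: measurable_funB.
move=> w; have /andP[s0 s1] := m01 (Z w).
rewrite normrM (@le_trans _ _ `|m (Z w) - c|)//.
  rewrite ler_piMr// indicE; case: (_ \in _); rewrite ?normr1 ?normr0//.
by rewrite (le_trans (ler_normB _ _))// lerD2r ger0_norm.
Qed.

Lemma Rintegral_cond_probability : \int[P]_w m (Z w) = fine (P A).
Proof.
case: Am => _ _ /(_ setT measurableT); rewrite preimage_setT /Rintegral => ->.
by rewrite integral_indic// setIT.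
Qed.

(** Turns integrals over events of [Z] into joint probabilities, the quantities that a copula
    describes. *)
Lemma Rintegral_excess_on c (B : set R) : measurable B ->
  \int[P]_w ((m (Z w) - c) * \1_(Z @^-1` B) w) =
  fine (P (A `&` Z @^-1` B)) - c * fine (P (Z @^-1` B)).
Proof.
move=> mB; have mZB : measurable (Z @^-1` B) by exact: measurable_funPTI.
transitivity (\int[P]_(w in Z @^-1` B) (m (Z w) - c)).
  rewrite [RHS]Rintegral_mkcond; apply: eq_Rintegral => w _.
  by rewrite patchE indicE; case: ifPn; rewrite ?mulr1 ?mulr0.
rewrite RintegralB//; last 2 first.
- exact: integrableS imZ.
- by apply: integrableS (integrable_cst_fun P c).
rewrite Rintegral_cst//; congr (_ - _).
by case: Am => _ _ /(_ B mB); rewrite /Rintegral => ->; rewrite integral_indic.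
Qed.

(** The left side is the mean of [(m(Z) - c) * xi] with [xi] equal to 1 below [z], to [l] at [z] and
    to 0 above; a factor in [[0, 1]] never lifts a number above its positive part. *)
Lemma excess_ge_atom c z l : 0 <= l <= 1 ->
  (fine (P (A `&` [set w | Z w < z])) + l * fine (P (A `&` [set w | Z w = z])))
  - c * (fine (P [set w | Z w < z]) + l * fine (P [set w | Z w = z]))
  <= \int[P]_w ex c w.
Proof.
move=> /andP[l0 l1].
have eqE : [set w | Z w = z] = Z @^-1` [set z] by [].
have mlt : measurable (Z @^-1` `]-oo, z[) by exact: measurable_funPTI.
have meq : measurable (Z @^-1` [set z]) by exact: measurable_funPTI.
rewrite set_lt_preimage eqE.
have -> : forall a b c' d', a + l * b - c * (c' + l * d') =
  (a - c * c') + l * (b - c * d') by move=> *; ring.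
rewrite -!Rintegral_excess_on//.
rewrite -RintegralZl//; last exact: iimZc.
rewrite -RintegralD//; [|exact: iimZc|exact/integrableZl_fun/iimZc].
apply: le_Rintegral => //.
  by apply: integrableD_fun; [exact: iimZc|exact/integrableZl_fun/iimZc].
move=> w _; rewrite /ex.
set a := m (Z w) - c.
have ma : a <= Num.max a 0 by rewrite le_max lexx.
have m0 : 0 <= Num.max a 0 by rewrite le_max lexx orbT.
have -> : \1_(Z @^-1` `]-oo, z[) w = (Z w < z)%R%:R :> R.
  rewrite indicE; congr (nat_of_bool _)%:R.
  by apply/idP/idP; rewrite inE /= in_itv.
have -> : \1_(Z @^-1` [set z]) w = (Z w == z)%:R :> R.
  by rewrite indicE; congr (nat_of_bool _)%:R; apply/idP/eqP; rewrite inE.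
by case: ltgtP => _ /=; rewrite ?(mulr0, mulr1, addr0, add0r)//; nra.
Qed.

(** The positive part is [m(Z) - c] restricted to [m(Z) > c], and for decreasing [m] this event is
    almost surely a lower half-line event of [Z]. *)
Lemma excess_eq_lower_set (A0 : set R) c :
  measurable A0 -> distribution P Z A0 = 1%E ->
  {in A0 &, {homo m : s t /~ s <= t}} ->
  exists D : set R, [/\ measurable D,
    [\/ D = set0, D = setT |
      exists b z, D = [set` Interval -oo%O (BSide b z)]] &
    \int[P]_w ex c w =
      fine (P (A `&` Z @^-1` D)) - c * fine (P (Z @^-1` D))].
Proof.
move=> mA0 A01 mdec.
(* The downward closure makes [D] a lower set of the whole line, although [m] is monotone on [A0]
   only. *)
pose D := [set t | exists2 s, A0 s /\ c < m s & t <= s].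
have Ddown s t : D s -> t <= s -> D t.
  by move=> [u cu su] ts; exists u => //; exact: le_trans su.
have iD : is_interval D by move=> x y _ Dy z /andP[_ zy]; exact: Ddown zy.
have mD : measurable D by exact: is_interval_measurable.
exists D; split => //.
- have [->|/set0P[t Dt]] := eqVneq D set0; first by constructor 1.
  have [ubD|nubD] := pselect (has_ubound D); last first.
    constructor 2; apply/seteqP; split => // x _.
    have [y Dy xy] : exists2 y, D y & x <= y.
      apply: contrapT => h; apply: nubD; exists x => y Dy.
      by rewrite leNgt; apply/negP => /ltW xy; apply: h; exists y.
    exact: Ddown xy.
  (* The half-line is closed ([b] false) exactly when [D] contains its supremum. *)
  constructor 3; exists (~~ `[< D (sup D) >]), (sup D).
  rewrite {1}(is_intervalP D).1//; congr [set` Interval _ _].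
    rewrite asboolF// => -[x lbx].
    have Dmin : D (Num.min t (x - 1)) by apply: Ddown Dt _; rewrite ge_min lexx.
    by have := lbx _ Dmin; rewrite le_min => /andP[_]; lra.
  by rewrite asboolT.
- rewrite -Rintegral_excess_on//; congr fine.
  apply: ae_eq_integral => //.
  + exact: (measurable_int _ (iex c)).
  + exact: (measurable_int _ (iimZc c (measurable_funPTI Z mD))).
  have aeA0 : {ae P, forall w, A0 (Z w)}.
    exists (Z @^-1` (~` A0)); split => //.
      by apply: measurable_funPTI; exact: measurableC.
    have -> : Z @^-1` (~` A0) = ~` (Z @^-1` A0) by [].
    rewrite probability_setC; last exact: measurable_funPTI.
    by rewrite [P _]A01 subee.
  (* On [A0], membership in [D] means [m > c]: if [t <= s] and [c < m s], monotonicity gives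
     [c < m t]. *)
  apply: filterS aeA0 => w A0w _ /=; congr EFin; rewrite /ex indicE.
  have [mc|mc] := ltP c (m (Z w)).
    rewrite max_l ?subr_ge0 ?(ltW mc)//.
    by rewrite mem_set ?mulr1//; exists (Z w).
  rewrite max_r ?subr_le0// memNset ?mulr0//= => -[s [A0s cs] ws].
  have := mdec _ _ (mem_set A0s) (mem_set A0w) ws.
  by rewrite leNgt (le_lt_trans mc).
Qed.

End excess.

(** * Quantiles and copulas *)

Section distribution_functions.
Context d (T : measurableType d) (R : realType) (P : probability T R).

Lemma prob_cvg (F : (set T)^nat) (E : set T) :
  (forall n, measurable (F n)) -> {homo F : n m / (n <= m)%N >-> n `<=` m} ->
  E = \bigcup_n F n -> (fun n => fine (P (F n))) @ \oo --> fine (P E).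
Proof.
move=> mF ndF ->.
have mU : measurable (\bigcup_n F n) by exact: bigcupT_measurable.
apply: fine_cvg; rewrite fineK ?fin_num_measure//.
apply: nondecreasing_cvg_mu => // n m nm.
by apply/subsetPset; exact: ndF.
Qed.

Lemma prob_le (A B : set T) : measurable A -> measurable B -> A `<=` B ->
  fine (P A) <= fine (P B).
Proof.
by move=> mA mB AB; rewrite fine_le ?fin_num_measure// le_measure ?inE.
Qed.

(* Increases to [z], strictly below it iff [b]: the closed half-lines up to
   [below b z n] exhaust the half-line [-oo, BSide b z]. *)
Definition below (b : bool) (z : R) (n : nat) : R := z - b%:R / n.+1%:R.

Lemma below_mono b z : {homo below b z : n m / (n <= m)%N >-> n <= m}.
Proof.
move=> n m nm; rewrite /below lerD2l lerN2 ler_wpM2l//.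
by rewrite lef_pV2 ?posrE ?ltr0n// ler_nat.
Qed.

Lemma below_bigcup b z :
  [set` Interval -oo%O (BSide b z)] = \bigcup_n [set` `]-oo, below b z n]].
Proof.
apply/seteqP; split=> [x|x [n _]]; rewrite /= !in_itv/= /below; last first.
  case: b => /=; last by rewrite mul0r subr0.
  by move=> /le_lt_trans; apply; rewrite gtrBl divr_gt0.
case: b => /= xz; last by exists 0%N => //=; rewrite in_itv/= mul0r subr0.
have zx0 : 0 < z - x by rewrite subr_gt0.
exists (Num.truncn (z - x)^-1) => //=; rewrite in_itv/= div1r.
rewrite lerBrDr -lerBrDl -[leRHS]invrK lef_pV2 ?posrE ?ltr0n ?invr_gt0//.
exact/ltW/truncnS_gt.
Qed.

Context (Y : {RV P >-> R}).

Lemma dfE y : df Y y = fine (P (Y @^-1` `]-oo, y])).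
Proof. by []. Qed.

Lemma df_mono : {homo df Y : x y / x <= y}.
Proof.
move=> x y xy; rewrite /df fine_le ?cdf_nondecreasing// /cdf;
  exact: fin_num_measure.
Qed.

(** Continuity from below: [b = true] gives the left limit of the distribution function, while for
    [b = false] the sequence is constant. *)
Lemma df_below_cvg b z :
  df Y (below b z n) @[n --> \oo] -->
  fine (P (Y @^-1` [set` Interval -oo%O (BSide b z)])).
Proof.
apply: prob_cvg => [n|n m nm w|].
- exact: measurable_funPTI.
- by rewrite /= !in_itv/= => /le_trans; apply; exact: below_mono.
- by rewrite below_bigcup preimage_bigcup.
Qed.

Lemma has_inf_df v : 0 < v < 1 -> has_inf [set y | v <= df Y y].
Proof.
move=> /andP[v0 v1]; split.
  have lim1 : df Y x @[x --> +oo] --> (1 : R).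
    by apply: fine_cvg; exact: cvg_cdfy1.
  have [M [_ hM]] : \forall x \near +oo, v < df Y x.
    by move/cvgr_gt : lim1; exact.
  by exists (M + 1); apply/ltW/hM; rewrite ltrDl.
have lim0 : df Y x @[x --> -oo] --> (0 : R).
  by apply: fine_cvg; exact: cvg_cdfNy0.
have [M [_ hM]] : \forall x \near -oo, df Y x < v.
  by move/cvgr_lt : lim0; exact.
exists (M - 1) => x /= vx; rewrite leNgt; apply/negP => xM.
by have := hM x ltac:(lra); rewrite ltNge vx.
Qed.

Lemma df_lt_quantile y v : 0 < v < 1 -> y < quantile Y v -> df Y y < v.
Proof.
move=> v01 yq; rewrite ltNge; apply/negP => vy; move: yq; rewrite ltNge.
apply/negP/negPn; apply: ge_inf => //; exact: (has_inf_df v01).2.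
Qed.

(** By right continuity, a value below [v] at the infimum would persist just to its right, where
    points reaching level [v] must exist. *)
Lemma df_quantile v : 0 < v < 1 -> v <= df Y (quantile Y v).
Proof.
move=> v01; set q := quantile Y v.
rewrite leNgt; apply/negP => qv.
have rc : df Y x @[x --> q^'+] --> df Y q.
  apply: fine_cvg; rewrite fineK; first exact: cdf_right_continuous.
  exact: fin_num_measure.
have [e /= e0 he] : \forall x \near q^'+, df Y x < v.
  by move/cvgr_lt : rc; exact.
have [y /= vy yq] := inf_adherent e0 (has_inf_df v01).
have qy : q <= y by apply: ge_inf => //; exact: (has_inf_df v01).2.
move: qy; rewrite le_eqVlt => /predU1P[qy|qy].
  by move: qv; rewrite qy ltNge vy.
have := he y _ qy; rewrite ltNge vy => h; suff : false by [].
rewrite -[inf _]/q in yq.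
by apply: h; rewrite /= ltr0_norm; lra.
Qed.

Lemma prob_lt_quantile v : 0 < v < 1 ->
  fine (P (Y @^-1` `]-oo, quantile Y v[)) <= v.
Proof.
move=> v01; have h := @df_below_cvg true (quantile Y v).
rewrite -(cvg_lim _ h)//; apply: limr_le; first exact: (cvgP _ h).
apply: nearW => n; apply/ltW/df_lt_quantile => //.
by rewrite gtrBl divr_gt0.
Qed.

End distribution_functions.

Section quantile_levels.
Context (R : realType) d (T : measurableType d) (P : probability T R).
Context d' (T' : measurableType d') (P' : probability T' R).
Context (Y : {RV P >-> R}) (Y' : {RV P' >-> R}).

(** Each value [df Y y] with [y] below the quantile is less than [v] and is approximated by values
    [df Y' y'] that are also less than [v]; such [y'] lie below the quantile of [Y']. *)
Lemma prob_lt_quantile_le v : 0 < v < 1 ->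
  range (df Y) `<=` closure (range (df Y')) ->
  fine (P (Y @^-1` `]-oo, quantile Y v[)) <=
  fine (P' (Y' @^-1` `]-oo, quantile Y' v[)).
Proof.
move=> v01 YY'; have h := @df_below_cvg _ _ _ _ Y true (quantile Y v).
rewrite -(cvg_lim _ h)//; apply: limr_le; first exact: (cvgP _ h).
apply: nearW => n; set y := below _ _ _.
have yv : df Y y < v by apply: df_lt_quantile => //; rewrite gtrBl divr_gt0.
apply/ler_addgt0Pr => e e0.
(* The radius [e] controls the error; the radius [v - df Y y] keeps the approximating value below
   [v]. *)
have m0 : 0 < Num.min e (v - df Y y) by rewrite lt_min e0 subr_gt0.
have cl : closure (range (df Y')) (df Y y) by apply: YY'; exists y.
have [_ [[y' _ <-]]] := cl _ (nbhsx_ballx _ _ m0).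
rewrite /ball /= lt_min => /andP[h1 h2].
move: h1 h2; rewrite !ltr_norml => /andP[h1 h2] /andP[h3 h4].
apply: (@le_trans _ _ (df Y' y' + e)); first lra.
rewrite lerD2r dfE; apply: prob_le; [exact: measurable_funPTI..|].
move=> w /=; rewrite !in_itv/= => /le_lt_trans; apply.
rewrite ltNge; apply/negP => /(df_mono Y').
have := df_quantile Y' v01; lra.
Qed.

End quantile_levels.

(** * Lipschitz continuity of copulas *)

Section copula_continuity.
Context (R : realType) (C : R -> R -> R).
Hypothesis copC : is_copula C.

Lemma uniform_prob_itv_le (a b : R) : a <= b ->
  (uniform_prob (@ltr01 R) `]a, b]%classic <= (b - a)%:E)%E.
Proof.
move=> ab; rewrite /uniform_prob.
have -> : (b - a)%:E =
    (\int[lebesgue_measure]_(x in `]a, b]%classic) (1%:E : \bar R))%E.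
  rewrite integral_cst//= mul1e lebesgue_measure_itv/= lte_fin.
  by case: ltP => //= ba; congr EFin; lra.
apply: ge0_le_integral => //.
- by move=> x _; rewrite lee_fin uniform_pdf_ge0.
- apply/measurable_EFinP; apply: measurable_funTS.
  exact: measurable_uniform_pdf.
- by move=> x _; rewrite lee_fin /uniform_pdf subr0 invr1; case: ifP.
Qed.

(** The part of one quadrant outside the other lies in a vertical and a horizontal strip, whose
    masses are bounded by their widths since the marginals are uniform. *)
Lemma copula_le u v u' v' : C u v <= C u' v' + (`|u - u'| + `|v - v'|).
Proof.
case: copC => mu [mu1 mu2 CE]; rewrite !CE.
have mprod (a b : R) : measurable (`]-oo, a] `*` `]-oo, b] : set (R * R)).
  exact: measurableX.
have m1 (A : set R) : measurable A -> measurable (fst @^-1` A : set (R * R)).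
  by move=> mA; rewrite -[_ @^-1` _]setTI; exact: measurable_fst.
have m2 (A : set R) : measurable A -> measurable (snd @^-1` A : set (R * R)).
  by move=> mA; rewrite -[_ @^-1` _]setTI; exact: measurable_snd.
(* If [a < b] the interval is empty and the bound is trivial, so no order between the arguments is
   assumed. *)
have strip (a b : R) :
    (uniform_prob (@ltr01 R) `]b, a]%classic <= `|a - b|%:E)%E.
  have [ab|/ltW ab] := leP b a.
    by apply: le_trans (uniform_prob_itv_le ab) _; rewrite lee_fin ler_norm.
  by rewrite set_itv_ge ?measure0 ?lee_fin// bnd_simp -leNgt.
set V := `]-oo, u'] `*` `]-oo, v'].
have sub : `]-oo, u] `*` `]-oo, v] `<=`
    V `|` ((fst @^-1` `]u', u]) `|` (snd @^-1` `]v', v])).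
  move=> [x y] [/=]; rewrite !in_itv/= => xu yv.
  have [xu'|xu'] := leP x u'; last by right; left; rewrite /= xu.
  by have [yv'|yv'] := leP y v'; [left|right; right; rewrite /= yv].
have mS1 := m1 _ (measurable_itv `]u', u]).
have mS2 := m2 _ (measurable_itv `]v', v]).
have mS := measurableU _ _ mS1 mS2.
have mV : measurable V := mprod u' v'.
have le1 : (mu (`]-oo, u] `*` `]-oo, v]) <=
    mu V + (`|u - u'| + `|v - v'|)%:E)%E.
  apply: le_trans (le_measure _ _ _ sub) _; rewrite ?inE//.
    exact: measurableU mV mS.
  apply: le_trans (measureU2 _ mV mS) _.
  rewrite leeD2l// EFinD; apply: le_trans (measureU2 _ mS1 mS2) _.
  apply: leeD.
    by rewrite [leLHS](mu1 _ (measurable_itv _)); exact: (strip u u').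
  by rewrite [leLHS](mu2 _ (measurable_itv _)); exact: (strip v v').
have fU := fin_num_measure mu _ (mprod u v).
have fV := fin_num_measure mu _ mV.
by rewrite -lee_fin EFinD !fineK.
Qed.

Lemma copula_cvg (u v : R^nat) (a b : R) :
  u @ \oo --> a -> v @ \oo --> b -> C (u n) (v n) @[n --> \oo] --> C a b.
Proof.
move=> ua vb; apply/cvgrPdist_le => e e0.
have e2 : 0 < e / 2 by rewrite divr_gt0.
move/cvgrPdist_le : ua => /(_ _ e2); move/cvgrPdist_le : vb => /(_ _ e2).
apply: filterS2 => n vn un.
have h1 := copula_le a b (u n) (v n); have h2 := copula_le (u n) (v n) a b.
rewrite (distrC (u n)) (distrC (v n)) in h2.
by rewrite ler_norml; apply/andP; split; lra.
Qed.

End copula_continuity.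

(** * Copula identities for open half-lines *)

Section copula_limits.
Context (R : realType) d (T : measurableType d) (P : probability T R).
Context (C : R -> R -> R) (Y Z : {RV P >-> R}).
Hypothesis YZ : copula_of C Y Z.

Lemma joint_below_cvg (E : set T) (y : R) : measurable E ->
  fine (P (Y @^-1` `]-oo, below true y n] `&` E)) @[n --> \oo] -->
  fine (P (Y @^-1` `]-oo, y[ `&` E)).
Proof.
move=> mE; apply: prob_cvg => [n|n m nm|].
- by apply: measurableI => //; exact: measurable_funPTI.
- apply: setSI => w; rewrite /= !in_itv/= => /le_trans; apply.
  exact: below_mono.
- by rewrite (below_bigcup true y) preimage_bigcup setI_bigcupl.
Qed.

(** Sklar's identity covers closed half-lines. Approaching open ones from below, the probabilities
    converge by continuity of the measure and the copula values by Lipschitz continuity. *)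
Lemma copula_of_lower y b z :
  fine (P (Y @^-1` `]-oo, y[ `&` Z @^-1` [set` Interval -oo%O (BSide b z)])) =
  C (fine (P (Y @^-1` `]-oo, y[)))
    (fine (P (Z @^-1` [set` Interval -oo%O (BSide b z)]))).
Proof.
have [copC CE] := YZ.
have lim := copula_cvg copC (@df_below_cvg _ _ _ _ Y true y)
  (@df_below_cvg _ _ _ _ Z b z).
apply: cvg_unique lim => //.
suff : fine (P [set w | Y w <= below true y n /\ Z w <= below b z n])
    @[n --> \oo] -->
    fine (P (Y @^-1` `]-oo, y[ `&` Z @^-1` [set` Interval -oo%O (BSide b z)])).
  apply: cvg_trans; apply: near_eq_cvg; apply: nearW => n /=.
  by rewrite CE.
apply: prob_cvg => [n|n m nm w|].
- have -> : [set w | Y w <= below true y n /\ Z w <= below b z n] =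
    Y @^-1` `]-oo, below true y n] `&` Z @^-1` `]-oo, below b z n].
    by apply/seteqP; split => w /=; rewrite !in_itv.
  by apply: measurableI; exact: measurable_funPTI.
- move=> /= [Yn Zn]; split.
    exact: le_trans Yn (below_mono _ _ nm).
  exact: le_trans Zn (below_mono _ _ nm).
- rewrite (below_bigcup true y) (below_bigcup b z) !preimage_bigcup.
  apply/seteqP; split => w /=.
    move=> [[n _ /= +] [k _ /= +]]; rewrite !in_itv/= => Yn Zk.
    (* A common index serves both half-lines because each sequence is nondecreasing. *)
    exists (maxn n k) => //=; split.
      exact: le_trans Yn (below_mono _ _ (leq_maxl _ _)).
    exact: le_trans Zk (below_mono _ _ (leq_maxr _ _)).
  by move=> [n _ /= [Yn Zn]]; split; exists n => //=; rewrite in_itv.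
Qed.

(** The same limit, taken in the first argument only, replaces [Y <= y] by [Y < y]. *)
Lemma atoms_interpolated_lt y z l : atoms_interpolated C Y Z -> 0 <= l <= 1 ->
  C (fine (P (Y @^-1` `]-oo, y[)))
    (fine (P [set w | Z w < z]) + l * fine (P [set w | Z w = z])) =
  fine (P (Y @^-1` `]-oo, y[ `&` [set w | Z w < z]))
    + l * fine (P (Y @^-1` `]-oo, y[ `&` [set w | Z w = z])).
Proof.
move=> aC l01; have [copC _] := YZ.
have mlt : measurable [set w | Z w < z].
  by rewrite set_lt_preimage; exact: measurable_funPTI.
have meq : measurable [set w | Z w = z].
  exact: (measurable_funPTI Z (measurable_set1 z)).
set s := _ + l * fine (P [set w | Z w = z]).
have cst (a : R) : (fun _ : nat => a) @ \oo --> a by exact: cvg_cst.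
have lim1 := copula_cvg copC (@df_below_cvg _ _ _ _ Y true y) (cst s).
apply: cvg_unique lim1 _ => //.
suff : fine (P (Y @^-1` `]-oo, below true y n] `&` [set w | Z w < z])) +
    l * fine (P (Y @^-1` `]-oo, below true y n] `&` [set w | Z w = z]))
    @[n --> \oo] -->
    fine (P (Y @^-1` `]-oo, y[ `&` [set w | Z w < z])) +
    l * fine (P (Y @^-1` `]-oo, y[ `&` [set w | Z w = z])).
  apply: cvg_trans; apply: near_eq_cvg; apply: nearW => n /=.
  rewrite /s aC//; congr (fine (P _) + l * fine (P _));
    by apply/seteqP; split => w /=; rewrite in_itv.
apply: cvgD; first exact: joint_below_cvg.
by apply: cvgM; [exact: cst|exact: joint_below_cvg].
Qed.

End copula_limits.

(** * Convex order from joint probabilities on half-lines *)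

Section comparison.
Context (R : realType) d (T : measurableType d) (P : probability T R).
Context d' (T' : measurableType d') (P' : probability T' R).
Context (Z : {RV P >-> R}) (A : set T) (m : R -> R).
Context (Z' : {RV P' >-> R}) (A' : set T') (m' : R -> R).
Hypotheses (mA : measurable A) (m01 : forall t, 0 <= m t <= 1)
  (Am : cond_probability A Z m).
Hypotheses (mA' : measurable A') (m'01 : forall t, 0 <= m' t <= 1)
  (Am' : cond_probability A' Z' m').
Hypothesis AA' : fine (P A) = fine (P' A').

(** [J] and [J'] give the joint probability as a function of the level of the half-line. They will
    be sections of the copulas for the event [Y < q], and [s - C a s] and its analogue for
    [Y >= q]. *)
Lemma convex_order_of_lower_sets (A0 : set R) (J J' : R -> R) :
  measurable A0 -> distribution P Z A0 = 1%E ->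
  {in A0 &, {homo m : s t /~ s <= t}} ->
  (forall b z, let D := [set` Interval -oo%O (BSide b z)] in
    fine (P (A `&` Z @^-1` D)) = J (fine (P (Z @^-1` D)))) ->
  (forall z l, 0 <= l <= 1 ->
    fine (P' (A' `&` [set w | Z' w < z]))
      + l * fine (P' (A' `&` [set w | Z' w = z])) =
    J' (fine (P' [set w | Z' w < z]) + l * fine (P' [set w | Z' w = z]))) ->
  (forall s, 0 <= s <= 1 -> J s <= J' s) ->
  convex_order P P' (fun w => m (Z w)) (fun w => m' (Z' w)).
Proof.
move=> mA0 A01 mdec AJ AJ' JJ'.
have mm : measurable_fun setT (fun w => m (Z w)).
  by apply: measurableT_comp => //; case: Am.
have mm' : measurable_fun setT (fun w => m' (Z' w)).
  by apply: measurableT_comp => //; case: Am'.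
apply: convex_order_of_excess => //.
  by rewrite (Rintegral_cond_probability mA Am)
    (Rintegral_cond_probability mA' Am').
move=> c; have [D [mD Dcase ->]] :=
  excess_eq_lower_set mA m01 Am c mA0 A01 mdec.
have mZD : measurable (Z @^-1` D) by exact: measurable_funPTI.
set s := fine (P (Z @^-1` D)).
have s0 : 0 <= s by rewrite fine_ge0.
have s1 : s <= 1.
  by rewrite -lee_fin fineK ?fin_num_measure// probability_le1.
have AD : fine (P (A `&` Z @^-1` D)) <= s.
  by apply: prob_le => //; exact: measurableI.
have AA : fine (P (A `&` Z @^-1` D)) <= fine (P A).
  by apply: prob_le => //; exact: measurableI.
(* Quantiles are available at levels strictly between 0 and 1 only. At level 0 the excess is at most
   0. *)
have [ss|sn0] := eqVneq s 0.
  apply: (@le_trans _ _ 0); first by rewrite ss mulr0 subr0 -ss.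
  by apply: Rintegral_ge0 => w _; rewrite le_max lexx orbT.
have [ss|sn1] := eqVneq s 1.
  (* At level 1 the excess is at most [P(A) - c], which equals the mean of [m'(Z') - c] and is thus
     at most the excess on the other side. *)
  apply: (@le_trans _ _ (fine (P' A') - c)).
    by rewrite ss mulr1 lerD2r -AA'.
  have imZ' := unit_integrable P' mm' (fun w => m'01 (Z' w)).
  rewrite -(Rintegral_cond_probability mA' Am') -{1}(Rintegral_cstT P' c).
  rewrite -RintegralB//; last exact: integrable_cst_fun.
  apply: le_Rintegral => //.
  - by apply: integrableD_fun => //; exact: integrable_cst_fun.
  - exact: (@excess_integrable _ _ _ P' (fun w => m' (Z' w))).
  - by move=> w _; rewrite le_max lexx.
have s01 : 0 < s < 1 by rewrite !lt_neqAle s0 s1 eq_sym sn0 sn1.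
have [b [z DE]] : exists b z, D = [set` Interval -oo%O (BSide b z)].
  case: Dcase => // DE; move: sn0 sn1; rewrite /s DE.
    by rewrite preimage_set0 measure0 eqxx.
  by rewrite preimage_setT/= probability_setT eqxx.
pose z' := quantile Z' s.
(* The level [s] lies between [P'(Z' < z')] and [P'(Z' <= z')]; [l] is its relative position in this
   gap, or 0 if [z'] is not an atom. *)
have [l l01 sE] : exists2 l, 0 <= l <= 1 &
    s = fine (P' [set w | Z' w < z']) + l * fine (P' [set w | Z' w = z']).
  have lo := prob_lt_quantile Z' s01.
  have hi := df_quantile Z' s01.
  have dfD : df Z' z' = fine (P' (Z' @^-1` `]-oo, z'[)) +
      fine (P' (Z' @^-1` [set z'])).
    rewrite dfE -fineD ?fin_num_measure//; try exact: measurable_funPTI.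
    rewrite -measureU//; try exact: measurable_funPTI.
      by rewrite -preimage_setU setUitv1.
    rewrite -preimage_setI; apply/seteqP; split => w //= [].
    by rewrite in_itv/= => + h; rewrite h ltxx.
  rewrite set_lt_preimage.
  set a := fine (P' (Z' @^-1` `]-oo, z'[)) in lo dfD *.
  set p := fine (P' (Z' @^-1` [set z'])) in dfD.
  have -> : fine (P' [set w | Z' w = z']) = p by [].
  have p0 : 0 <= p by rewrite fine_ge0.
  have [pE|pN] := eqVneq p 0.
    by exists 0; rewrite ?lexx ?ler01// mul0r addr0; apply/le_anti; lra.
  have pp : 0 < p by rewrite lt_neqAle eq_sym pN.
  exists ((s - a) / p); last by rewrite divfK// subrKC.
  by rewrite divr_ge0 ?subr_ge0// ler_pdivrMr// mul1r; lra.
(* The split half-line has weight exactly [s], so both sides subtract [c * s] and only [J s <= J' s]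
   remains. *)
apply: le_trans (excess_ge_atom mA' m'01 Am' c z' l01).
by rewrite AJ' // -sE lerD2r DE AJ -DE; apply: JJ'; rewrite s0.
Qed.

End comparison.

(** * Comparison theorem *)

Section monotone_versions.
Context (R : realType) d (T : measurableType d) (P : probability T R).
Context (Z : {RV P >-> R}).

(** Removing from [A] a null set that contains all points of disagreement lets monotonicity pass
    from one version to another. *)
Lemma version_eq_on (xi : T -> R) (m n : R -> R) (A : set R) :
  cond_expectation xi Z m -> cond_expectation xi Z n ->
  measurable A -> distribution P Z A = 1%E ->
  exists A1, [/\ measurable A1, distribution P Z A1 = 1%E, A1 `<=` A &
    forall t, A1 t -> m t = n t].
Proof.
move=> cm cn mA A1; have [N [mN N0 sub]] := cond_expectation_unique cm cn.
exists (A `\` N); split.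
- exact: measurableD.
- apply/eqP; rewrite eq_le; apply/andP; split.
    by apply: probability_le1; exact: measurableD.
  rewrite -A1 (measureDI (distribution P Z) mA mN).
  have AN0 : distribution P Z (A `&` N) = 0%E.
    by apply: subset_measure0 N0 => //; exact: measurableI.
  by rewrite [X in (_ + X <= _)%E]AN0 adde0.
- by move=> t [].
- by move=> t [_ nN]; apply: contrapT => h; apply: nN; exact: sub.
Qed.

Lemma cond_expectationN (xi : T -> R) (m : R -> R) :
  P.-integrable setT (EFin \o xi) ->
  cond_expectation (fun w => - xi w) Z m ->
  cond_expectation xi Z (fun t => - m t).
Proof.
move=> ixi [mm im e]; split.
- exact: measurable_funN.
- by under eq_fun do rewrite EFinN; exact: integrableN.
- move=> B mB; have mZB : measurable (Z @^-1` B) by exact: measurable_funPTI.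
  under eq_integral do rewrite EFinN.
  rewrite integralN/=; last first.
    by apply: integrable_add_def => //; exact: integrableS im.
  rewrite e//; under eq_integral do rewrite EFinN.
  rewrite integralN/= ?oppeK//.
  by apply: integrable_add_def => //; exact: integrableS ixi.
Qed.

Lemma cond_probability_setC (A : set T) (m : R -> R) : measurable A ->
  cond_probability A Z m -> cond_probability (~` A) Z (fun t => 1 - m t).
Proof.
move=> mA [mm im e]; have i1 := integrable_cst_fun P 1; split.
- exact: measurable_funB.
- exact: (integrableB measurableT i1 im).
- move=> B mB; have mZB : measurable (Z @^-1` B) by exact: measurable_funPTI.
  rewrite integral_indic//; last exact: measurableC.
  rewrite integralB_EFin//; last 2 first.
  + exact: integrableS i1.
  + exact: integrableS im.
  rewrite e// integral_indic// integral_cst// mul1e.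
  rewrite (measureDI P mZB mA) (setIC A) addeK ?setDE 1?setIC//.
  by rewrite fin_num_measure//; exact: measurableI.
Qed.

Context (Y : {RV P >-> R}) (q : R).
Let f (t : R) : R := \1_(`[q, +oo[%classic : set R) t.

Let f_mono : {homo f : x y / x <= y}.
Proof.
move=> x y xy; rewrite /f !indicE !mem_setE !in_itv/= !andbT ler_nat.
by have [/le_trans /(_ xy) ->|] := leP q x.
Qed.

Let mYq : measurable (Y @^-1` `[q, +oo[).
Proof. exact: measurable_funPTI. Qed.

Let if_ : P.-integrable setT (fun w => (\1_(Y @^-1` `[q, +oo[) w)%:E).
Proof. exact: integrable_indic. Qed.

(** The indicator of [[q, +oo[] is an increasing test function; the monotone version it yields is
    then compared with [n]. *)
Lemma stoch_increasing_version (n : R -> R) : stoch_increasing Y Z ->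
  cond_probability (Y @^-1` `[q, +oo[) Z n ->
  exists A, [/\ measurable A, distribution P Z A = 1%E &
    {in A &, {homo n : s t / s <= t}}].
Proof.
move=> incYZ cn; have [m [cm [A [mA A1 mmono]]]] := incYZ f f_mono if_.
have [B [mB B1 BA mn]] := version_eq_on cm cn mA A1.
exists B; split => // s t /set_mem Bs /set_mem Bt st.
by rewrite -!mn//; apply: mmono => //; apply/mem_set/BA.
Qed.

(** The test function must increase in [- Y]: [f'] at [- Y] is minus the indicator of [Y >= q], so
    its increasing version is minus a decreasing version of the conditional probability. *)
Lemma stoch_decreasing_version (n : R -> R) : stoch_decreasing Y Z ->
  cond_probability (Y @^-1` `[q, +oo[) Z n ->
  exists A, [/\ measurable A, distribution P Z A = 1%E &
    {in A &, {homo n : s t /~ s <= t}}].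
Proof.
move=> decYZ cn; pose f' t := - f (- t).
have f'_mono : {homo f' : x y / x <= y}.
  by move=> x y xy; rewrite lerN2 f_mono// lerN2.
have f'E w : f' (- Y w) = - \1_(Y @^-1` `[q, +oo[) w.
  by rewrite /f' opprK.
have if' : P.-integrable setT (fun w => (f' (- Y w))%:E).
  under eq_fun do rewrite f'E EFinN.
  exact: integrableN.
have [m [cm [A [mA A1 mmono]]]] := decYZ f' f'_mono if'.
have cm' : cond_probability (Y @^-1` `[q, +oo[) Z (fun t => - m t).
  apply: cond_expectationN => //; move: cm; congr cond_expectation.
  by apply/funext => w; rewrite f'E.
have [B [mB B1 BA mn]] := version_eq_on cm' cn mA A1.
exists B; split => // s t /set_mem Bs /set_mem Bt st.
by rewrite -!mn// lerN2; apply: mmono => //; apply/mem_set/BA.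
Qed.

End monotone_versions.

(** The common reduction for all three claims: arbitrary versions given [X] and [X'] are replaced by
    functions of [g(X)] and [h(X')] with values in [[0, 1]] everywhere. *)
Lemma sufficient_ccx_order (R : realType)
    d (T : measurableType d) (P : probability T R)
    d' (T' : measurableType d') (P' : probability T' R)
    dS (S : measurableType dS) dS' (S' : measurableType dS')
    (Y : {RV P >-> R}) (X : {RV P >-> S})
    (Y' : {RV P' >-> R}) (X' : {RV P' >-> S'})
    (g : {mfun S >-> R}) (h : {mfun S' >-> R})
    (gX : {RV P >-> R} := (g \o X : {mfun T >-> R}))
    (hX' : {RV P' >-> R} := (h \o X' : {mfun T' >-> R})) :
  sufficient g Y X -> sufficient h Y' X' ->
  (forall v (n n' : R -> R), 0 < v < 1 ->
    (forall t, 0 <= n t <= 1) -> (forall t, 0 <= n' t <= 1) ->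
    cond_probability (Y @^-1` `[quantile Y v, +oo[) gX n ->
    cond_probability (Y' @^-1` `[quantile Y' v, +oo[) hX' n' ->
    convex_order P P' (fun w => n (gX w)) (fun w => n' (hX' w))) ->
  ccx_order Y X Y' X'.
Proof.
move=> sg sh H v v01 m m'; rewrite !set_ge_preimage => cm cm'.
have mq (r : R) : measurable (`[r, +oo[%classic : set R).
  exact: measurable_itv.
have [n [mn n01 cn nE]] := sufficient_cond_probability sg (mq (quantile Y v)).
have [n' [mn' n'01 cn' n'E]] :=
  sufficient_cond_probability sh (mq (quantile Y' v)).
apply: convex_order_ae (nE _ cm) (n'E _ cm') _.
- by apply: measurableT_comp => //; case: cm.
- by apply: (measurableT_comp mn); exact: (measurable_funPT gX).
- by apply: measurableT_comp => //; case: cm'.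
- by apply: (measurableT_comp mn'); exact: (measurable_funPT hX').
- exact: H v n n' v01 n01 n'01 cn cn'.
Qed.

(** * From concordance of copulas to convex order *)

Section copula_comparison.
Context (R : realType) d (T : measurableType d) (P : probability T R).
Context d' (T' : measurableType d') (P' : probability T' R).
Context (Y Z : {RV P >-> R}) (Y' Z' : {RV P' >-> R}) (C C' : R -> R -> R).
Hypothesis ranE : closure (range (df Y)) = closure (range (df Y')).
Hypotheses (YZ : copula_of C Y Z) (YZ' : copula_of C' Y' Z').
Hypothesis aC' : atoms_interpolated C' Y' Z'.
Context (v : R) (n n' : R -> R).
Hypotheses (v01 : 0 < v < 1)
  (n01 : forall t, 0 <= n t <= 1) (n'01 : forall t, 0 <= n' t <= 1).
Let q := quantile Y v.
Let q' := quantile Y' v.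
Hypotheses (cn : cond_probability (Y @^-1` `[q, +oo[) Z n)
  (cn' : cond_probability (Y' @^-1` `[q', +oo[) Z' n').

Let a := fine (P (Y @^-1` `]-oo, q[)).
Let a' := fine (P' (Y' @^-1` `]-oo, q'[)).

Let aa' : a = a'.
Proof.
apply/le_anti/andP; split; apply: prob_lt_quantile_le => //.
  by rewrite -ranE; exact: subset_closure.
by rewrite ranE; exact: subset_closure.
Qed.

Let a01 : 0 <= a <= 1.
Proof.
rewrite /a fine_ge0//= -lee_fin fineK ?fin_num_measure//.
  by apply: probability_le1; exact: measurable_funPTI.
exact: measurable_funPTI.
Qed.

Let ltC d0 (T0 : measurableType d0) (P0 : probability T0 R)
    (W : {RV P0 >-> R}) r : ~` (W @^-1` `[r, +oo[) = W @^-1` `]-oo, r[.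
Proof. by rewrite preimage_setC setCitvr. Qed.

(** Since [n] increases, the half-line argument is applied to the complementary event [Y < q], whose
    conditional probability [1 - n] decreases. *)
Lemma convex_order_increasing : stoch_increasing Y Z ->
  concordance_le C C' ->
  convex_order P P' (fun w => n (Z w)) (fun w => n' (Z' w)).
Proof.
move=> incYZ CC'.
have [A0 [mA0 A01 nmono]] := stoch_increasing_version incYZ cn.
have mYq : measurable (Y @^-1` `[q, +oo[) by exact: measurable_funPTI.
have mYq' : measurable (Y' @^-1` `[q', +oo[) by exact: measurable_funPTI.
have := cond_probability_setC mYq cn; have := cond_probability_setC mYq' cn'.
rewrite !ltC => c' c.
(* Testing with the reflection of [phi] undoes the passage to complements. *)
suff refl : convex_order P P' (fun w => 1 - n (Z w)) (fun w => 1 - n' (Z' w)).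
  move=> phi cphi; have := refl _ (convex_reflect cphi).
  under eq_fun do rewrite subKr.
  by under [X in (_ <= 'E_P'[X])%E -> _]eq_fun do rewrite subKr.
apply: (@convex_order_of_lower_sets _ _ _ _ _ _ _ Z _ (fun t => 1 - n t)
  Z' _ (fun t => 1 - n' t) _ _ c _ _ c' aa' A0 (C a) (C' a)) => //.
- exact: measurable_funPTI.
- by move=> t; have := n01 t; lra.
- exact: measurable_funPTI.
- by move=> t; have := n'01 t; lra.
- by move=> s t As At st; rewrite lerD2l lerN2 nmono.
- by move=> b z D; rewrite (copula_of_lower YZ).
- by move=> z l l01; rewrite aa' -(atoms_interpolated_lt YZ').
- by move=> s s01; exact: CC'.
Qed.

(** Here [n] itself decreases, so the event is [Y >= q]. Its joint probability with a half-line of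
    level [s] is [s - C a s], which reverses the order of the copulas. *)
Lemma convex_order_decreasing : stoch_decreasing Y Z ->
  concordance_le C' C ->
  convex_order P P' (fun w => n (Z w)) (fun w => n' (Z' w)).
Proof.
move=> decYZ CC'.
have [A0 [mA0 A01 nmono]] := stoch_decreasing_version decYZ cn.
have mYq : measurable (Y @^-1` `[q, +oo[) by exact: measurable_funPTI.
have mYq' : measurable (Y' @^-1` `[q', +oo[) by exact: measurable_funPTI.
have split_prob d0 (T0 : measurableType d0) (P0 : probability T0 R)
    (W : {RV P0 >-> R}) r (E : set T0) : measurable E ->
    fine (P0 (W @^-1` `[r, +oo[ `&` E)) =
    fine (P0 E) - fine (P0 (W @^-1` `]-oo, r[ `&` E)).
  move=> mE; rewrite -ltC.
  have mW : measurable (W @^-1` `[r, +oo[) by exact: measurable_funPTI.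
  rewrite (measureDI P0 mE mW) fineD ?fin_num_measure//;
    [|exact: measurableD|exact: measurableI].
  by rewrite [E `&` _]setIC setDE [E `&` _]setIC; ring.
have probE d0 (T0 : measurableType d0) (P0 : probability T0 R)
    (W : {RV P0 >-> R}) r :
    fine (P0 (W @^-1` `[r, +oo[)) = 1 - fine (P0 (W @^-1` `]-oo, r[)).
  have := split_prob _ _ P0 W r _ measurableT.
  by rewrite !setIT/= probability_setT.
apply: (@convex_order_of_lower_sets _ _ _ _ _ _ _ Z _ n Z' _ n'
  _ _ cn _ _ cn' _ A0 (fun s => s - C a s) (fun s => s - C' a s)) => //.
- by rewrite !probE -/a -/a' aa'.
- move=> b z D; have mZD : measurable (Z @^-1` D).
    by apply: measurable_funPTI; exact: measurable_itv.
  by rewrite split_prob// (copula_of_lower YZ).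
- move=> z l l01; rewrite aa' (atoms_interpolated_lt YZ')//.
  have mlt : measurable [set w | Z' w < z].
    by rewrite set_lt_preimage; exact: measurable_funPTI.
  have meq : measurable [set w | Z' w = z].
    exact: (measurable_funPTI Z' (measurable_set1 z)).
  by rewrite !split_prob//; ring.
- by move=> s s01; rewrite lerD2l lerN2; exact: CC'.
Qed.

End copula_comparison.

Theorem theorem3p3 (R : realType)
    (d : measure_display) (T : measurableType d) (P : probability T R)
    (d' : measure_display) (T' : measurableType d') (P' : probability T' R)
    (p p' : nat)
    (Y : {RV P >-> R}) (X : {RV P >-> p.-tuple R})
    (Y' : {RV P' >-> R}) (X' : {RV P' >-> p'.-tuple R})
    (g : {mfun p.-tuple R >-> R}) (h : {mfun p'.-tuple R >-> R})
    (gX : {RV P >-> R} := (g \o X : {mfun T >-> R}))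
    (hX' : {RV P' >-> R} := (h \o X' : {mfun T' >-> R}))
    (g_sufficient : sufficient g Y X) (h_sufficient : sufficient h Y' X') :
  [/\ (ccx_order Y gX Y' hX' -> ccx_order Y X Y' X'),

      (closure (range (df Y)) = closure (range (df Y')) ->
       stoch_increasing Y gX -> stoch_increasing Y' hX' ->
       forall C C' : R -> R -> R,
         copula_of C Y gX -> copula_of C' Y' hX' ->
         atoms_interpolated C' Y' hX' ->
         concordance_le C C' -> ccx_order Y X Y' X') &

      (closure (range (df Y)) = closure (range (df Y')) ->
       stoch_decreasing Y gX -> stoch_decreasing Y' hX' ->
       forall C C' : R -> R -> R,
         copula_of C Y gX -> copula_of C' Y' hX' ->
         atoms_interpolated C' Y' hX' ->
         concordance_le C' C -> ccx_order Y X Y' X')].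
Proof.
split.
(* The functions produced by the reduction are themselves versions given [gX] and [hX'], so the
   assumed order applies to them directly. *)
- move=> gh; apply: sufficient_ccx_order g_sufficient h_sufficient _.
  move=> v n n' v01 _ _ cn cn'; apply: gh v01 _ _ _ _.
    by rewrite set_ge_preimage.
  by rewrite set_ge_preimage.
- move=> ranE inc _ C C' cC cC' aC' CC'.
  apply: sufficient_ccx_order g_sufficient h_sufficient _.
  move=> v n n' v01 n01 n'01 cn cn'.
  exact: (convex_order_increasing ranE cC cC' aC' v01 n01 n'01 cn cn' inc CC').
- move=> ranE dec _ C C' cC cC' aC' CC'.
  apply: sufficient_ccx_order g_sufficient h_sufficient _.
  move=> v n n' v01 n01 n'01 cn cn'.
  exact: (convex_order_decreasing ranE cC cC' aC' v01 n01 n'01 cn cn' dec CC').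
Qed.
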